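(* Let $(G,\mathcal{U},\varphi)$ be a self-similar ultragraph over a source-finite ultragraph $\mathcal{U}$ and let $(G,E_{\mathcal{U}},\phi)$ be the associated self-similar graph. Suppose also that $\varphi(g,e)\cdot v=g\cdot v$ for all $g\in G$, $e\in\mathcal{U}^1$ and $v\in s(e)$. Then $\mathcal{O}_{G,\mathcal{U}}\cong\mathcal{O}_{G,E_{\mathcal{U}}}$.
   Context: **Ultragraphs.** An ultragraph $\mathcal{U}=(U^0,\mathcal{U}^1,r,s)$ consists of a set $U^0$ of vertices, a set $\mathcal{U}^1$ of edges and maps $r,s:\mathcal{U}^1\to P(U^0)\setminus\{\emptyset\}$ ($P$ = power set) such that $r(e)$ is a singleton for every $e$. Standing assumption: $\mathcal{U}$ is row-finite without sources, i.e. $\{e\in\mathcal{U}^1: r(e)=\{v\}\}$ is nonempty and finite for all $v\in U^0$. $\mathcal{U}^0$ denotes the smallest subset of $P(U^0)$ containing $\emptyset$, all $\{v\}$ ($v\in U^0$), all $s(e)$ ($e\in\mathcal{U}^1$), and closed under finite $\cap,\cup,\setminus$. $\mathcal{U}$ is source-finite if $|s(e)|<\infty$ for all $e\in\mathcal{U}^1$. **Self-similar ultragraph.** A triple $(G,\mathcal{U},\varphi)$ where $\mathcal{U}=(U^0,\mathcal{U}^1,r,s)$ is a row-finite ultragraph without sources, $G$ is a countable discrete group with identity $1_G$ acting on $U^0\sqcup\mathcal{U}^1$ by ultragraph automorphisms (bijections preserving $U^0$ and $\mathcal{U}^1$ with $r(g\cdot e)=g\cdot r(e)$, $s(g\cdot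 e)=g\cdot s(e)$, where $g\cdot A=\{g\cdot v:v\in A\}$), and $\varphi:G\times\mathcal{U}^1\to G$ satisfies $\varphi(gh,e)=\varphi(g,h\cdot e)\varphi(h,e)$ and $\varphi(g,e)\cdot s(e)\subseteq g\cdot s(e)$. **The $C^*$-algebra $\mathcal{O}_{G,\mathcal{U}}$.** A Cuntz–Krieger $\mathcal{U}$-family consists of partial isometries $\{s_e:e\in\mathcal{U}^1\}$ with mutually orthogonal ranges and projections $\{p_A:A\in\mathcal{U}^0\}$ with (CK1) $p_\emptyset=0$, $p_Ap_B=p_{A\cap B}$, $p_{A\cup B}=p_A+p_B-p_{A\cap B}$; (CK2) $s_e^*s_e=p_{s(e)}$; (CK3) $s_es_e^*\le p_{r(e)}$; (CK4) $p_{\{v\}}=\sum_{r(e)=\{v\}}s_es_e^*$ for $v\in U^0$. A $(G,\mathcal{U})$-family is a collection $\{p_A,s_e\}\cup\{u_{A,g}:A\in\mathcal{U}^0,g\in G\}$ in a $C^*$-algebra such that (1) $\{p_A,s_e\}$ is a Cuntz–Krieger $\mathcal{U}$-family; (2) $u_{A,1_G}=p_A$; (3) $u_{A,g}^*=u_{g^{-1}\cdot A,g^{-1}}$; (4) $u_{A,g}u_{B,h}=u_{A\cap(g\cdot B),gh}$; (5) $u_{A,g}s_e=s_{g\cdot e}u_{g\cdot s(e),\varphi(g,e)}$ if $g\cdot r(e)\subseteq A$, and $u_{A,g}s_e=0$ otherwise. $\mathcal{O}_{G,\mathcal{U}}$ is the universal $C^*$-algebra generated by a $(G,\mathcal{U})$-family.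 **Associated graph.** $E_{\mathcal{U}}$ is the directed graph with vertex set $E_{\mathcal{U}}^0=U^0$ and edge set $E_{\mathcal{U}}^1=\{e^v:e\in\mathcal{U}^1,v\in s(e)\}$, with $r_E(e^v)=r(e)$ (the unique vertex in $r(e)$) and $s_E(e^v)=v$. $G$ acts on $E_{\mathcal{U}}^0=U^0$ as in $(G,\mathcal{U},\varphi)$ and on edges by $g\cdot e^v=(g\cdot e)^{g\cdot v}$, and $\phi(g,e^v)=\varphi(g,e)$. Under the hypothesis $\varphi(g,e)\cdot v=g\cdot v$ for $v\in s(e)$, $(G,E_{\mathcal{U}},\phi)$ is a self-similar graph, meaning that $G$ acts by graph automorphisms, $\phi(gh,f)=\phi(g,h\cdot f)\phi(h,f)$ and $\phi(g,f)\cdot s_E(f)=g\cdot s_E(f)$ for all $g,h\in G$ and edges $f$. **Self-similar graph algebra.** For a self-similar graph $(G,E,\phi)$ with $E$ row-finite and without sources, the Exel–Pardo algebra $\mathcal{O}_{G,E}$ is the universal $C^*$-algebra generated by mutually orthogonal projections $q_v$ ($v\in E^0$), partial isometries $t_f$ ($f\in E^1$) with mutually orthogonal ranges and elements $z_{v,g}$ ($v\in E^0,g\in G$) such that $t_f^*t_f=q_{s(f)}$, $t_ft_f^*\le q_{r(f)}$, $q_v=\sum_{r(f)=v}t_ft_f^*$, $z_{v,1_G}=q_v$, $z_{v,g}^*=z_{g^{-1}\cdot v,g^{-1}}$, $z_{v,g}z_{w,h}=\delta_{v,g\cdot w}z_{v,gh}$, and $z_{v,g}t_f=\delta_{v,g\cdot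 r(f)}\,t_{g\cdot f}z_{g\cdot s(f),\phi(g,f)}$. *)

(* Defs.v *)
From HB Require Import structures.
From mathcomp Require Import all_boot all_order all_algebra.
From mathcomp Require Import complex.
From mathcomp Require Import all_classical all_reals all_analysis.

Set Implicit Arguments.
Unset Strict Implicit.
Unset Printing Implicit Defensive.

Import Order.TTheory GRing.Theory Num.Theory.
Import numFieldNormedType.Exports.

Local Open Scope classical_set_scope.
Local Open Scope ring_scope.
Local Open Scope complex_scope.

(** * C*-algebras *)

(* Complex C*-algebras, not assumed unital: the algebras of ultragraphs with
   infinitely many vertices have no unit, so the product is not the one of
   MathComp's ring structures. *)
HB.mixin Record CompleteNormedModule_isCStarAlgebra (R : realType) A
    of CompleteNormedModule R[i] A := {
  cmul : A -> A -> A ;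
  star : A -> A ;
  cmulA : associative cmul ;
  cmulDl : left_distributive cmul +%R ;
  cmulDr : right_distributive cmul +%R ;
  cmulZl : forall (a : R[i]) (x y : A), cmul (a *: x) y = a *: cmul x y ;
  cmulZr : forall (a : R[i]) (x y : A), cmul x (a *: y) = a *: cmul x y ;
  starD : {morph star : x y / x + y} ;
  starZ : forall (a : R[i]) (x : A), star (a *: x) = (a^*)%R *: star x ;
  starM : forall x y : A, star (cmul x y) = cmul (star y) (star x) ;
  starK : involutive star ;
  normr_cmul : forall x y : A, `|cmul x y| <= `|x| * `|y| ;
  cstar_identity : forall x : A, `|cmul (star x) x| = `|x| ^+ 2
}.

#[short(type="cstarAlgType")]
HB.structure Definition CStarAlgebra (R : realType) :=
  {A of CompleteNormedModule_isCStarAlgebra R A & CompleteNormedModule R[i] A}.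

Declare Scope cstar_scope.
Delimit Scope cstar_scope with cstar.
Notation "x ** y" := (cmul x y)
  (at level 40, left associativity) : cstar_scope.
Local Open Scope cstar_scope.

Section CStarTheory.
Variables (R : realType) (A : cstarAlgType R).
Implicit Types p q s x y : A.

Definition projection p := p ** p = p /\ star p = p.

(* The order on projections. *)
Definition proj_le p q := p ** q = p.

Definition partial_isometry s := projection (star s ** s).

Definition range_proj s := s ** star s.

Definition star_subalgebra (S : set A) :=
  [/\ S 0,
      forall (a : R[i]) x y, S x -> S y -> S (a *: x + y),
      forall x y, S x -> S y -> S (x ** y)
    & forall x, S x -> S (star x)].

(* The C*-subalgebra C*(X) generated by X. *)
Definition cstar_generated (X : set A) : set A :=
  smallest [set S | closed S /\ star_subalgebra S] X.

End CStarTheory.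

(* No continuity is asked for: it is automatic. *)
Definition star_morphism (R : realType) (A B : cstarAlgType R) (f : A -> B) :=
  [/\ linear f, {morph f : x y / x ** y} & {morph f : x / star x}].

Definition cstar_isomorphic (R : realType) (A B : cstarAlgType R) :=
  exists f : A -> B, star_morphism f /\ bijective f.

(** * Ultragraphs *)

(* The types of vertices and edges are choice types so that finite sums can be
   indexed by them; classically this is no restriction. *)
Record ultragraph := Ultragraph {
  uvert : choiceType ;
  uedge : choiceType ;
  urng : uedge -> set uvert ;
  usrc : uedge -> set uvert ;
  urng_singleton : forall e, exists v, urng e = [set v] ;
  usrc_neq0 : forall e, usrc e !=set0
}.

Definition urow_finite (U : ultragraph) :=
  forall v : uvert U, finite_set [set e | urng e = [set v]].

Definition uwithout_sources (U : ultragraph) :=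
  forall v : uvert U, [set e | urng e = [set v]] !=set0.

Definition usource_finite (U : ultragraph) :=
  forall e : uedge U, finite_set (usrc e).

Definition ugenerators (U : ultragraph) : set (set (uvert U)) :=
  [set A | [\/ A = set0, exists v, A = [set v] | exists e, A = usrc e]].

(* The lattice of generalized vertices, i.e. the set U^0 in calligraphic U. *)
Definition uvertices (U : ultragraph) : set (set (uvert U)) :=
  smallest
    [set F | [/\ forall A B, F A -> F B -> F (A `&` B),
                 forall A B, F A -> F B -> F (A `|` B)
               & forall A B, F A -> F B -> F (A `\` B)]]
    (@ugenerators U).

Definition is_action (G : groupType) (T : Type) (act : G -> T -> T) :=
  (forall x, act 1%g x = x) /\
  (forall g h x, act (g * h)%g x = act g (act h x)).

(* An action on the disjoint union of vertices and edges that preserves both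
   parts is a pair of actions. *)
Record ss_ultragraph (G : groupType) (U : ultragraph) := SSUltragraph {
  ssu_countable : countable [set: G] ;
  ssu_row_finite : urow_finite U ;
  ssu_without_sources : uwithout_sources U ;
  ssu_vact : G -> uvert U -> uvert U ;
  ssu_eact : G -> uedge U -> uedge U ;
  ssu_vactP : is_action ssu_vact ;
  ssu_eactP : is_action ssu_eact ;
  ssu_rng_act : forall g e, urng (ssu_eact g e) = ssu_vact g @` urng e ;
  ssu_src_act : forall g e, usrc (ssu_eact g e) = ssu_vact g @` usrc e ;
  ssu_phi : G -> uedge U -> G ;
  ssu_phiM : forall g h e,
    ssu_phi (g * h)%g e = (ssu_phi g (ssu_eact h e) * ssu_phi h e)%g ;
  ssu_phi_src : forall g e,
    ssu_vact (ssu_phi g e) @` usrc e `<=` ssu_vact g @` usrc e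
}.

Section UltragraphFamilies.
Variables (R : realType) (G : groupType) (U : ultragraph).

(* Only the values of ufam_p and ufam_u at the sets of uvertices U are
   meaningful; the other ones are never used. *)
Record ufamily (A : cstarAlgType R) := UFamily {
  ufam_p : set (uvert U) -> A ;
  ufam_s : uedge U -> A ;
  ufam_u : set (uvert U) -> G -> A
}.

Record CK_ufamily (A : cstarAlgType R)
    (p : set (uvert U) -> A) (s : uedge U -> A) : Prop := CKUFamily {
  CKu_proj : forall X, uvertices X -> projection (p X) ;
  CKu_pisom : forall e, partial_isometry (s e) ;
  CKu_orth : forall e f, e <> f -> range_proj (s e) ** range_proj (s f) = 0 ;
  CKu_p0 : p set0 = 0 ;
  CKu_pI : forall X Y, uvertices X -> uvertices Y ->
    p X ** p Y = p (X `&` Y) ;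
  CKu_pU : forall X Y, uvertices X -> uvertices Y ->
    p (X `|` Y) = p X + p Y - p (X `&` Y) ;
  CKu_src : forall e, star (s e) ** s e = p (usrc e) ;
  CKu_rng : forall e, proj_le (range_proj (s e)) (p (urng e)) ;
  CKu_sum : forall v,
    p [set v] = \sum_(e \in [set e | urng e = [set v]]) range_proj (s e)
}.

Variable S : ss_ultragraph G U.

Local Notation vact := (ssu_vact S).
Local Notation eact := (ssu_eact S).
Local Notation phi := (ssu_phi S).

Record is_ufamily (A : cstarAlgType R) (F : ufamily A) : Prop := IsUFamily {
  ufam_CK : CK_ufamily (ufam_p F) (ufam_s F) ;
  ufam_u1 : forall X, uvertices X -> ufam_u F X 1%g = ufam_p F X ;
  ufam_star : forall X g, uvertices X ->
    star (ufam_u F X g) = ufam_u F (vact g^-1%g @` X) g^-1%g ;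
  ufam_uM : forall X Y g h, uvertices X -> uvertices Y ->
    ufam_u F X g ** ufam_u F Y h =
    ufam_u F (X `&` (vact g @` Y)) (g * h)%g ;
  ufam_us : forall X g e, uvertices X -> vact g @` urng e `<=` X ->
    ufam_u F X g ** ufam_s F e =
    ufam_s F (eact g e) ** ufam_u F (vact g @` usrc e) (phi g e) ;
  ufam_us0 : forall X g e, uvertices X -> ~ (vact g @` urng e `<=` X) ->
    ufam_u F X g ** ufam_s F e = 0
}.

Definition ufam_generators (A : cstarAlgType R) (F : ufamily A) : set A :=
  [set ufam_p F X | X in @uvertices U] `|` range (ufam_s F) `|`
  [set x | exists X g, uvertices X /\ x = ufam_u F X g].

Definition ufam_map (A B : cstarAlgType R) (F : ufamily A) (F' : ufamily B)
    (f : A -> B) :=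
  [/\ forall X, uvertices X -> f (ufam_p F X) = ufam_p F' X,
      forall e, f (ufam_s F e) = ufam_s F' e
    & forall X g, uvertices X -> f (ufam_u F X g) = ufam_u F' X g].

(* A is the algebra O_{G,U}: it is generated by a (G,U)-family through which
   every (G,U)-family in a C*-algebra factors uniquely. *)
Definition is_ss_ultragraph_algebra (A : cstarAlgType R) :=
  exists F : ufamily A,
    [/\ is_ufamily F,
        cstar_generated (ufam_generators F) = setT
      & forall (B : cstarAlgType R) (F' : ufamily B), is_ufamily F' ->
          exists! f : A -> B, star_morphism f /\ ufam_map F F' f].

End UltragraphFamilies.

(** * Directed graphs *)

Record digraph := Digraph {
  gvert : choiceType ;
  gedge : choiceType ;
  grng : gedge -> gvert ;
  gsrc : gedge -> gvert
}.

Definition grow_finite (E : digraph) :=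
  forall v : gvert E, finite_set [set f | grng f = v].

Definition gwithout_sources (E : digraph) :=
  forall v : gvert E, [set f | grng f = v] !=set0.

Record ss_graph (G : groupType) (E : digraph) := SSGraph {
  ssg_vact : G -> gvert E -> gvert E ;
  ssg_eact : G -> gedge E -> gedge E ;
  ssg_vactP : is_action ssg_vact ;
  ssg_eactP : is_action ssg_eact ;
  ssg_rng_act : forall g f, grng (ssg_eact g f) = ssg_vact g (grng f) ;
  ssg_src_act : forall g f, gsrc (ssg_eact g f) = ssg_vact g (gsrc f) ;
  ssg_phi : G -> gedge E -> G ;
  ssg_phiM : forall g h f,
    ssg_phi (g * h)%g f = (ssg_phi g (ssg_eact h f) * ssg_phi h f)%g ;
  ssg_phi_src : forall g f,
    ssg_vact (ssg_phi g f) (gsrc f) = ssg_vact g (gsrc f)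
}.

Section GraphFamilies.
Variables (R : realType) (G : groupType) (E : digraph).

Record gfamily (A : cstarAlgType R) := GFamily {
  gfam_q : gvert E -> A ;
  gfam_t : gedge E -> A ;
  gfam_z : gvert E -> G -> A
}.

Variable S : ss_graph G E.

Local Notation vact := (ssg_vact S).
Local Notation eact := (ssg_eact S).
Local Notation phi := (ssg_phi S).

Record is_gfamily (A : cstarAlgType R) (F : gfamily A) : Prop := IsGFamily {
  gfam_proj : forall v, projection (gfam_q F v) ;
  gfam_qorth : forall v w, v <> w -> gfam_q F v ** gfam_q F w = 0 ;
  gfam_pisom : forall f, partial_isometry (gfam_t F f) ;
  gfam_torth : forall e f, e <> f ->
    range_proj (gfam_t F e) ** range_proj (gfam_t F f) = 0 ;
  gfam_src : forall f, star (gfam_t F f) ** gfam_t F f = gfam_q F (gsrc f) ;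
  gfam_rng : forall f,
    proj_le (range_proj (gfam_t F f)) (gfam_q F (grng f)) ;
  gfam_sum : forall v,
    gfam_q F v = \sum_(f \in [set f | grng f = v]) range_proj (gfam_t F f) ;
  gfam_z1 : forall v, gfam_z F v 1%g = gfam_q F v ;
  gfam_star : forall v g,
    star (gfam_z F v g) = gfam_z F (vact g^-1%g v) g^-1%g ;
  gfam_zM : forall v w g h,
    gfam_z F v g ** gfam_z F w h =
    if v == vact g w then gfam_z F v (g * h)%g else 0 ;
  gfam_zt : forall v g f,
    gfam_z F v g ** gfam_t F f =
    if v == vact g (grng f)
    then gfam_t F (eact g f) ** gfam_z F (vact g (gsrc f)) (phi g f) else 0
}.

Definition gfam_generators (A : cstarAlgType R) (F : gfamily A) : set A :=
  range (gfam_q F) `|` range (gfam_t F) `|`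
  [set x | exists v g, x = gfam_z F v g].

Definition gfam_map (A B : cstarAlgType R) (F : gfamily A) (F' : gfamily B)
    (f : A -> B) :=
  [/\ forall v, f (gfam_q F v) = gfam_q F' v,
      forall e, f (gfam_t F e) = gfam_t F' e
    & forall v g, f (gfam_z F v g) = gfam_z F' v g].

(* A is the Exel-Pardo algebra O_{G,E}; the notion is meant for row-finite E
   without sources. *)
Definition is_ss_graph_algebra (A : cstarAlgType R) :=
  exists F : gfamily A,
    [/\ is_gfamily F,
        cstar_generated (gfam_generators F) = setT
      & forall (B : cstarAlgType R) (F' : gfamily B), is_gfamily F' ->
          exists! f : A -> B, star_morphism f /\ gfam_map F F' f].

End GraphFamilies.

(** * The graph associated with an ultragraph *)

Section AssociatedGraph.
Variable U : ultragraph.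

Definition urng_vert (e : uedge U) : uvert U := sval (cid (urng_singleton e)).

Lemma urng_vertE e : urng e = [set urng_vert e].
Proof. exact: svalP (cid (urng_singleton e)). Qed.

Lemma urng_eq1 (e : uedge U) v : (urng e = [set v]) <-> (urng_vert e = v).
Proof.
rewrite urng_vertE; split=> [/seteqP[+ _]|->//].
by move/(_ (urng_vert e) erefl).
Qed.

(* The edge e^v is the pair (e, v). *)
Definition agraph_edge : choiceType :=
  {x : uedge U * uvert U | x.2 \in usrc x.1}.

Definition assoc_graph : digraph :=
  @Digraph (uvert U) agraph_edge
    (fun f => urng_vert (sval f).1) (fun f => (sval f).2).

Lemma assoc_graph_without_sources :
  uwithout_sources U -> gwithout_sources assoc_graph.
Proof.
move=> Uns v; have [e /urng_eq1 ev] := Uns v; have [w ew] := usrc_neq0 e.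
by exists (exist _ (e, w) (mem_set ew)).
Qed.

Lemma assoc_graph_row_finite :
  urow_finite U -> usource_finite U -> grow_finite assoc_graph.
Proof.
move=> Urf Usf v.
pose P := \bigcup_(e in [set e : uedge U | urng e = [set v]])
  [set (e, w) | w in usrc e].
have finP : finite_set P.
  by apply: bigcup_finite => // e _; exact: finite_image.
have inj : {in [set f : agraph_edge | urng_vert (sval f).1 = v] &,
    injective (fun f : agraph_edge => sval f)}.
  by move=> x y _ _; exact: val_inj.
rewrite /grow_finite /= -(eq_finite_set (inj_card_eq inj)).
apply: sub_finite_set finP => _ [[[e w] /= ew] ev <-].
by exists e => /=; [exact/urng_eq1|exists w => //; exact: set_mem].
Qed.

Variables (G : groupType) (S : ss_ultragraph G U).

Lemma agraph_eact_subproof (g : G) (f : agraph_edge) :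
  ssu_vact S g (sval f).2 \in usrc (ssu_eact S g (sval f).1).
Proof.
by apply/mem_set; rewrite ssu_src_act; exists (sval f).2 => //; exact/set_mem/(svalP f).
Qed.

Definition agraph_eact (g : G) (f : agraph_edge) : agraph_edge :=
  exist _ (ssu_eact S g (sval f).1, ssu_vact S g (sval f).2)
    (agraph_eact_subproof g f).

Lemma agraph_eactP : is_action agraph_eact.
Proof.
have [v1 vM] := ssu_vactP S; have [e1 eM] := ssu_eactP S.
split=> [x|g h x]; apply: val_inj => /=.
  by rewrite v1 e1; case: (sval x).
by rewrite vM eM.
Qed.

Lemma urng_vert_act g e :
  urng_vert (ssu_eact S g e) = ssu_vact S g (urng_vert e).
Proof. by apply/urng_eq1; rewrite ssu_rng_act urng_vertE image_set1. Qed.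

Hypothesis phi_vact : forall g e v, usrc e v ->
  ssu_vact S (ssu_phi S g e) v = ssu_vact S g v.

Definition assoc_ss_graph : ss_graph G assoc_graph :=
  @SSGraph G assoc_graph (ssu_vact S) agraph_eact
    (ssu_vactP S) agraph_eactP
    (fun g f => urng_vert_act g (sval f).1)
    (fun g f => erefl)
    (fun g f => ssu_phi S g (sval f).1)
    (fun g h f => ssu_phiM S g h (sval f).1)
    (fun g f => phi_vact g (set_mem (svalP f))).

End AssociatedGraph.

(* Main.v *)
Require Import Defs.
From mathcomp Require Import all_boot all_order all_algebra.
From mathcomp Require Import all_classical all_reals all_analysis.

(** Both algebras are universal, so the isomorphism comes from translating
    each kind of family into the other inside one and the same C*-algebra.

    Since U is source-finite, every generalized vertex is a finite set of
    vertices, and p_X is the sum of the projections p_{v} over v in X. Hence a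
    (G,U)-family is determined by its pieces at single vertices, and these are
    a family for the associated graph (graph_familyP):
      q_v = p_{v},   t_(e^v) = s_e p_{v},   z_(v,g) = u_({v},g).
    Conversely a family for the associated graph adds up to a (G,U)-family
    (ultragraph_familyP), all the sums being finite:
      p_X = sum of q_v for v in X,   s_e = sum of t_(e^v) for v in s(e),
      u_(X,g) = sum of z_(v,g) for v in X.
    The hypothesis that phi(g,e) acts on s(e) as g does is what makes the two
    commutation relations u s = s u and z t = t z match: the summand of
    s_(g.e) u_(g.s(e),phi(g,e)) that meets p_{w} on the right is the one at the
    vertex phi(g,e).w, which must be g.w, the source of g.e^w.

    The translations undo each other (ufam_p_sum, ufam_s_sum, ufam_u_sum one
    way, gfam_s_z1 and one-term sums the other way). So the morphisms that the
    universal properties attach to the translated families compose to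
    endomorphisms fixing the universal families, and by uniqueness these are
    the identities. *)

Set Implicit Arguments.
Unset Strict Implicit.
Unset Printing Implicit Defensive.

Import GRing.Theory Num.Theory.

Local Open Scope classical_set_scope.
Local Open Scope ring_scope.
Local Open Scope cstar_scope.

(** * Finite sums *)

Section FiniteSums.
Implicit Types (I J : choiceType) (V W : zmodType).

Lemma fsum_morph I V W (f : V -> W) (X : set I) (F : I -> V) :
  f 0 = 0 -> {morph f : x y / x + y} -> finite_set X ->
  f (\sum_(i \in X) F i) = \sum_(i \in X) f (F i).
Proof. by move=> f0 fD finX; rewrite !fsbig_finite// (big_morph f fD f0). Qed.

Lemma fsum_delta I V (X : set I) (a : I) (F : I -> V) :
  \sum_(i \in X) (if a == i then F i else 0) = if a \in X then F a else 0.
Proof.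
have Xa : X `&` [set a] = if a \in X then [set a] else set0.
  case: ifPn => [/set_mem|/negP] aX; apply/seteqP; split=> i.
  - by move=> [].
  - by move=> ->.
  - by move=> [Xi ia]; apply: aX; rewrite -ia inE.
  - by [].
transitivity (\sum_(i \in X `&` [set a]) F i).
  rewrite fsbig_mkcondr; apply: eq_fsbigr => i _.
  by congr (if _ then _ else _); apply/eqP/idP => [->|]; rewrite inE.
by rewrite Xa; case: ifP => _; rewrite ?fsbig_set1 ?fsbig_set0.
Qed.

Lemma fsumU I V (X Y : set I) (F : I -> V) :
  finite_set X -> finite_set Y ->
  \sum_(i \in X `|` Y) F i =
  \sum_(i \in X) F i + \sum_(i \in Y) F i - \sum_(i \in X `&` Y) F i.
Proof.
move=> finX finY; rewrite (fsbigID X (X `|` Y)) ?finite_setU//=.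
rewrite (fsbigID X Y)//= setUK setIUl setICr set0U (setIC Y X).
by rewrite [in RHS](addrC (\sum_(i \in X `&` Y) _)) addrA addrK.
Qed.

(** The inner index sets are embedded in their union, which makes the range a
    product. *)
Lemma fsum_sigma I J V (P : set I) (Q : I -> set J) (F : I -> J -> V) :
  finite_set P -> (forall i, P i -> finite_set (Q i)) ->
  \sum_(i \in P) \sum_(j \in Q i) F i j = \sum_(x \in P `*`` Q) F x.1 x.2.
Proof.
move=> finP finQ; pose D := \bigcup_(i in P) Q i.
have finD : finite_set D by exact: bigcup_finite.
have -> : P `*`` Q = (P `*` D) `&` [set x | Q x.1 x.2].
  apply/seteqP; split=> [[i j] [/= Pi Qij]|[i j] [[/= Pi _] /= Qij]] //.
  by split=> //; split=> //; exists i.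
rewrite fsbig_mkcondr.
rewrite -(pair_fsbig _ (fun i j =>
  if (i, j) \in [set x | Q x.1 x.2] then F i j else 0))//.
apply: eq_fsbigr => i /set_mem Pi.
have {1}-> : Q i = D `&` Q i.
  by apply/seteqP; split=> [j Qij|j []//]; split=> //; exists i.
by rewrite fsbig_mkcondr; apply: eq_fsbigr => j _; congr (if _ then _ else _);
  apply/idP/idP; rewrite !inE.
Qed.

End FiniteSums.

(** * Calculus in a C*-algebra *)

Section CStarCalculus.
Variables (R : realType) (A : cstarAlgType R).
Implicit Types p s t x y : A.

Lemma cmul0l x : 0 ** x = 0.
Proof. by apply: (addrI (0 ** x)); rewrite -cmulDl !addr0. Qed.

Lemma cmul0r x : x ** 0 = 0.
Proof. by apply: (addrI (x ** 0)); rewrite -cmulDr !addr0. Qed.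

Lemma star0 : star (0 : A) = 0.
Proof. by apply: (addrI (star 0)); rewrite -starD !addr0. Qed.

Lemma starN x : star (- x) = - star x.
Proof. by apply/eqP; rewrite -subr_eq0 opprK -starD addNr star0. Qed.

Lemma cmulNl x y : (- x) ** y = - (x ** y).
Proof. by apply/eqP; rewrite -subr_eq0 opprK -cmulDl addNr cmul0l. Qed.

Lemma cmulNr x y : x ** (- y) = - (x ** y).
Proof. by apply/eqP; rewrite -subr_eq0 opprK -cmulDr addNr cmul0r. Qed.

Lemma cstar_eq0 x : star x ** x = 0 -> x = 0.
Proof.
move=> xx0; apply/eqP; rewrite -normr_eq0 -sqrf_eq0.
by rewrite -(cstar_identity x) xx0 normr0.
Qed.

Section Sums.
Variable I : choiceType.
Implicit Types (X : set I) (F : I -> A).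

Lemma cmul_fsuml X F y : finite_set X ->
  (\sum_(i \in X) F i) ** y = \sum_(i \in X) (F i ** y).
Proof.
by apply: (fsum_morph (f := fun x => x ** y)) => [|u v];
  rewrite ?cmul0l ?cmulDl.
Qed.

Lemma cmul_fsumr X F y : finite_set X ->
  y ** (\sum_(i \in X) F i) = \sum_(i \in X) (y ** F i).
Proof.
by apply: (fsum_morph (f := fun x => y ** x)) => [|u v];
  rewrite ?cmul0r ?cmulDr.
Qed.

Lemma star_fsum X F : finite_set X ->
  star (\sum_(i \in X) F i) = \sum_(i \in X) star (F i).
Proof. by apply: fsum_morph; [exact: star0|exact: starD]. Qed.

End Sums.

Lemma cmul_fsum (I J : choiceType) (X : set I) (Y : set J)
    (F : I -> A) (H : J -> A) : finite_set X -> finite_set Y ->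
  (\sum_(i \in X) F i) ** (\sum_(j \in Y) H j) =
  \sum_(i \in X) \sum_(j \in Y) (F i ** H j).
Proof.
by move=> finX finY; rewrite cmul_fsuml//; apply: eq_fsbigr => i _;
  exact: cmul_fsumr.
Qed.

(** A partial isometry is defined here by its source projection. By the
    C*-identity, s - s p with p = star s ** s vanishes because its square norm
    is that of p - p p - p p + p p p = 0. *)
Lemma partial_isometryE s : partial_isometry s -> s ** star s ** s = s.
Proof.
move=> [pp sp]; apply/esym/eqP; rewrite -subr_eq0; apply/eqP/cstar_eq0.
rewrite -cmulA; set p := star s ** s in pp sp *.
rewrite starD starN starM sp cmulDr !cmulDl !cmulNl !cmulNr.
rewrite -!cmulA [star s ** (s ** p)]cmulA -/p !pp.
by rewrite !subrr [star s ** _]cmulA pp opprK addNr addr0.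
Qed.

Lemma star_partial_isometryE s : partial_isometry s ->
  star s ** range_proj s = star s.
Proof.
by move=> /partial_isometryE /(congr1 star); rewrite !starM starK cmulA.
Qed.

Lemma range_proj_star s x : partial_isometry s ->
  range_proj s ** x = range_proj s -> star s ** x = star s.
Proof.
move=> /star_partial_isometryE sE sx.
by rewrite -{1}sE -cmulA sx sE.
Qed.

(** The partial isometries absorb their range projections, so the product of
    the latter appears between [star s] and [t]. *)
Lemma range_proj_orth s t : partial_isometry s -> partial_isometry t ->
  range_proj s ** range_proj t = 0 -> star s ** t = 0.
Proof.
move=> /star_partial_isometryE sE /partial_isometryE tE st.
rewrite -sE -tE -/(range_proj t) -cmulA (cmulA (range_proj s)) st.
by rewrite cmul0l cmul0r.
Qed.

End CStarCalculus.

Lemma star_morphism_fsum (R : realType) (A B : cstarAlgType R) (f : A -> B)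
    (I : choiceType) (X : set I) (F : I -> A) :
  star_morphism f -> finite_set X ->
  f (\sum_(i \in X) F i) = \sum_(i \in X) f (F i).
Proof.
move=> [lf _ _]; have fD : {morph f : x y / x + y}.
  by move=> x y; rewrite -[x]scale1r lf !scale1r.
by apply: fsum_morph => //; apply: (addrI (f 0)); rewrite -fD !addr0.
Qed.

Lemma star_morphism_id (R : realType) (A : cstarAlgType R) :
  star_morphism (@id A).
Proof. by []. Qed.

Lemma star_morphism_comp (R : realType) (A B C : cstarAlgType R)
    (f : A -> B) (g : B -> C) :
  star_morphism f -> star_morphism g -> star_morphism (g \o f).
Proof.
move=> [lf mf sf] [lg mg sg].
by split=> [a x y|x y|x] /=; rewrite ?lf ?mf ?sf ?lg ?mg ?sg.
Qed.

(** * Generalized vertices and edges of a source-finite ultragraph *)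

Section SourceFinite.
Variable U : ultragraph.
Hypothesis Usf : usource_finite U.

(** The finite sets are closed under the lattice operations and contain all
    the generators. *)
Lemma uvertices_finite X : @uvertices U X -> finite_set X.
Proof.
apply: (smallest_sub (X := @finite_set (uvert U))).
  split=> Y Z finY finZ; first exact: finite_setIl.
    by rewrite finite_setU.
  by apply: sub_finite_set finY; exact: subDsetl.
move=> Y [->|[v ->]|[e ->]]; [exact: finite_set0|exact: finite_set1|exact: Usf].
Qed.

Lemma uvertices_set0 : @uvertices U set0.
Proof. by apply: sub_gen_smallest; constructor 1. Qed.

Lemma uvertices_set1 v : @uvertices U [set v].
Proof. by apply: sub_gen_smallest; constructor 2; exists v. Qed.

Lemma uvertices_src e : @uvertices U (usrc e).
Proof. by apply: sub_gen_smallest; constructor 3; exists e. Qed.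

Lemma uverticesU X Y : @uvertices U X -> @uvertices U Y ->
  @uvertices U (X `|` Y).
Proof.
move=> UX UY F FP; have [[_ FU _] _] := FP.
by apply: FU; [exact: UX|exact: UY].
Qed.

Lemma set_cons (T : choiceType) (x : T) (s : seq T) :
  [set` x :: s] = [set x] `|` [set` s].
Proof.
apply/seteqP; split=> y /=; rewrite inE.
  by case/orP=> [/eqP|]; [left|right].
by case=> [->|ys]; rewrite ?eqxx ?ys ?orbT.
Qed.

Lemma uvertices_seq (s : seq (uvert U)) : @uvertices U [set` s].
Proof.
elim: s => [|v s IHs]; first by rewrite set_nil; exact: uvertices_set0.
by rewrite set_cons; apply: uverticesU => //; exact: uvertices_set1.
Qed.

(** The fibre of the range map of the associated graph over v is fibred in
    turn over the edges of the ultragraph with range v. The relation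
    that decomposes the projection at v passes between the two kinds of
    families through this lemma. *)
Lemma agraph_fsum (V : zmodType) (H : uedge U * uvert U -> V) v :
  urow_finite U ->
  \sum_(f \in [set f : gedge (assoc_graph U) | grng f = v]) H (sval f) =
  \sum_(e \in [set e : uedge U | urng e = [set v]])
    \sum_(w \in usrc e) H (e, w).
Proof.
move=> Urf; rewrite (fsum_sigma (fun e w => H (e, w)) (Urf v)); last first.
  by move=> e _; exact: Usf.
set P := [set f | _].
have -> : [set e | urng e = [set v]] `*`` (@usrc U) = sval @` P.
  apply/seteqP; split=> [[e w] [/= /urng_eq1 ev ew]|_ [[[e w] /= ew] ev <-]].
    by exists (exist _ (e, w) (mem_set ew)).
  by split; [exact/urng_eq1|exact/set_mem].
rewrite fsbig_image; first by apply: eq_fsbigr => -[[e w] ew].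
by move=> f f' _ _; exact: val_inj.
Qed.

End SourceFinite.

(** * The action on vertices *)

Section VertexAction.
Variables (G : groupType) (U : ultragraph) (S : ss_ultragraph G U).
Local Notation vact := (ssu_vact S).

Lemma vact1_image (X : set (uvert U)) : vact 1%g @` X = X.
Proof.
have [v1 _] := ssu_vactP S; apply/seteqP; split=> [_ [v Xv <-]|v Xv].
  by rewrite v1.
by exists v.
Qed.

Lemma vactK g : cancel (vact g) (vact g^-1%g).
Proof. by move=> v; rewrite -(ssu_vactP S).2 mulVg (ssu_vactP S).1. Qed.

Lemma vact_inj g : injective (vact g).
Proof. exact: can_inj (vactK g). Qed.

Lemma vact_eq g v w : (v == vact g w) = (vact g^-1%g v == w).
Proof.
apply/eqP/eqP => [->|<-]; first exact: vactK.
by rewrite -{1}(invgK g) vactK.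
Qed.

Lemma in_vact_image g v (X : set (uvert U)) :
  (v \in vact g @` X) = (vact g^-1%g v \in X).
Proof.
apply/idP/idP; rewrite !inE; first by case=> w Xw <-; rewrite vactK.
by move=> Xv; exists (vact g^-1%g v); rewrite // -{1}(invgK g) vactK.
Qed.

End VertexAction.

(** * From ultragraph families to graph families *)

Section UltragraphToGraph.
Variables (R : realType) (G : groupType) (U : ultragraph).
Variable S : ss_ultragraph G U.
Hypothesis Usf : usource_finite U.
Hypothesis phi_vact : forall g e v, usrc e v ->
  ssu_vact S (ssu_phi S g e) v = ssu_vact S g v.
Variables (A : cstarAlgType R) (F : ufamily G U A).
Hypothesis isF : is_ufamily S F.

Local Notation vact := (ssu_vact S).
Local Notation p := (ufam_p F).
Local Notation s := (ufam_s F).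
Local Notation u := (ufam_u F).
Let CK : CK_ufamily p s := ufam_CK isF.

Lemma ufam_pu X Y g : uvertices X -> uvertices Y ->
  p X ** u Y g = u (X `&` Y) g.
Proof.
by move=> UX UY; rewrite -(ufam_u1 isF)// (ufam_uM isF)// vact1_image mul1g.
Qed.

Lemma ufam_up X Y g : uvertices X -> uvertices Y ->
  u X g ** p Y = u (X `&` (vact g @` Y)) g.
Proof.
by move=> UX UY; rewrite -(ufam_u1 isF)// (ufam_uM isF)// mulg1.
Qed.

(** This is the C*-identity again: the square of u_(empty,g) is p_empty. *)
Lemma ufam_u0 g : u set0 g = 0.
Proof.
have U0 := @uvertices_set0 U; apply: cstar_eq0.
rewrite (ufam_star isF)// image_set0 (ufam_uM isF)// set0I mulVg.
by rewrite (ufam_u1 isF)// (CKu_p0 CK).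
Qed.

Lemma ufam_sp e : s e ** p (usrc e) = s e.
Proof.
by rewrite -(CKu_src CK) cmulA partial_isometryE//; exact: (CKu_pisom CK e).
Qed.

(** Finite additivity of p, by adding the vertices of X one at a time. *)
Lemma ufam_p_sum X : uvertices X -> p X = \sum_(v \in X) p [set v].
Proof.
move=> /(uvertices_finite Usf) /finite_seqP [r ->].
have -> : [set` r] = [set` undup r].
  by apply/seteqP; split=> v; rewrite /= mem_undup.
rewrite -fsbig_seq ?undup_uniq//; elim: (undup r) (undup_uniq r) => [|v t IHt].
  by rewrite set_nil big_nil (CKu_p0 CK).
move=> /= /andP[vt ut]; rewrite set_cons big_cons -IHt//.
have vt0 : [set v] `&` [set` t] = set0.
  by apply/seteqP; split=> // w [-> /= wt]; rewrite wt in vt.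
rewrite (CKu_pU CK) ?vt0 ?(CKu_p0 CK) ?subr0//; first exact: uvertices_set1.
exact: uvertices_seq.
Qed.

Lemma ufam_s_sum e : s e = \sum_(v \in usrc e) (s e ** p [set v]).
Proof.
by rewrite -cmul_fsumr// -ufam_p_sum ?ufam_sp//; exact: uvertices_src.
Qed.

Lemma ufam_u_sum X g : uvertices X -> u X g = \sum_(v \in X) u [set v] g.
Proof.
move=> UX; rewrite -{1}(setIid X) -ufam_pu// ufam_p_sum//.
rewrite cmul_fsuml; last exact: (uvertices_finite Usf).
apply: eq_fsbigr => v /set_mem Xv.
rewrite ufam_pu//; last exact: uvertices_set1.
by congr (u _ g); apply/setIidl => _ ->.
Qed.

Lemma ufam_pp v w :
  p [set v] ** p [set w] = if v == w then p [set v] else 0.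
Proof.
rewrite (CKu_pI CK); try exact: uvertices_set1.
case: eqVneq => [->|vw]; first by rewrite setIid.
suff -> : [set v] `&` [set w] = set0 by rewrite (CKu_p0 CK).
by apply/seteqP; split=> // _ [->] /= vw'; rewrite vw' eqxx in vw.
Qed.

Lemma ufam_range_proj e v :
  range_proj (s e ** p [set v]) = s e ** p [set v] ** star (s e).
Proof.
have [_ pv] := CKu_proj CK (uvertices_set1 v).
by rewrite /range_proj starM pv cmulA -(cmulA (s e)) ufam_pp eqxx.
Qed.

(** Both the source projections of the elements s_e p_{v} and the orthogonality
    of their ranges are read off from this product. *)
Lemma ufam_star_ss e f v w : usrc e v ->
  p [set v] ** star (s e) ** (s f ** p [set w]) =
  if (e == f) && (v == w) then p [set v] else 0.
Proof.
move=> ev; rewrite -cmulA (cmulA _ (s f)).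
case: eqVneq => [<-|ef] /=; last first.
  rewrite (range_proj_orth (CKu_pisom CK e) (CKu_pisom CK f)).
    by rewrite cmul0l cmul0r.
  by apply: (CKu_orth CK); exact/eqP.
have [Uv Ue] := (uvertices_set1 v, uvertices_src e).
rewrite (CKu_src CK) cmulA (CKu_pI CK)//.
by rewrite (_ : _ `&` _ = [set v]) ?ufam_pp//; apply/setIidl => _ ->.
Qed.

Definition graph_family : gfamily G (assoc_graph U) A :=
  @GFamily _ G (assoc_graph U) A (fun v => p [set v])
    (fun f => s (sval f).1 ** p [set (sval f).2]) (fun v g => u [set v] g).

Lemma graph_familyP : is_gfamily (assoc_ss_graph phi_vact) graph_family.
Proof.
have U1 := @uvertices_set1 U.
have star_p v : star (p [set v]) = p [set v] by have [] := CKu_proj CK (U1 v).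
split=> /=.
- by move=> v; exact: (CKu_proj CK (U1 v)).
- by move=> v w /eqP vw; rewrite ufam_pp (negPf vw).
- move=> f; rewrite /partial_isometry starM star_p ufam_star_ss ?eqxx/=.
    exact: (CKu_proj CK (U1 _)).
  exact/set_mem/(svalP f).
- move=> f f' ff'; rewrite /range_proj cmulA -(cmulA _ (star _)).
  rewrite starM star_p ufam_star_ss; last exact/set_mem/(svalP f).
  rewrite (_ : _ && _ = false) ?cmul0r ?cmul0l//.
  apply/negP => /andP[/eqP e1 /eqP e2]; apply: ff'; apply: val_inj => /=.
  by case: (sval f) (sval f') e1 e2 => e v [e' v'] /= -> ->.
- move=> f; rewrite starM star_p ufam_star_ss ?eqxx//.
  exact/set_mem/(svalP f).
- move=> f; rewrite /proj_le ufam_range_proj -urng_vertE -cmulA.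
  congr (_ ** _); apply: range_proj_star; first exact: (CKu_pisom CK _).
  exact: (CKu_rng CK _).
- move=> v; rewrite (CKu_sum CK).
  under [RHS]eq_fsbigr do rewrite ufam_range_proj.
  rewrite (agraph_fsum Usf (fun x => s x.1 ** p [set x.2] ** star (s x.1)))//;
    last exact: ssu_row_finite S.
  apply: eq_fsbigr => e _ /=.
  by rewrite /range_proj {1}ufam_s_sum cmul_fsuml.
- by move=> v; exact: (ufam_u1 isF (U1 v)).
- by move=> v g; rewrite (ufam_star isF) ?image_set1.
- move=> v w g h; rewrite (ufam_uM isF)// image_set1.
  case: eqVneq => [->|vw]; first by rewrite setIid.
  suff -> : [set v] `&` [set vact g w] = set0 by rewrite ufam_u0.
  by apply/seteqP; split=> // _ [->] /= vw'; rewrite vw' eqxx in vw.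
- move=> v g f; set e := (sval f).1; set w := (sval f).2.
  have ew : usrc e w by exact/set_mem/(svalP f).
  rewrite cmulA; case: eqVneq => [vg|/eqP vg]; last first.
    rewrite (ufam_us0 isF) ?cmul0l// urng_vertE image_set1 => sub.
    by apply: vg; rewrite -(sub _ erefl).
  rewrite (ufam_us isF)//; last by rewrite urng_vertE image_set1 vg.
  have Uge : uvertices (vact g @` usrc e).
    by rewrite -(ssu_src_act S); exact: uvertices_src.
  (* Both sides reduce to s_(g.e) u_({g.w}, phi g e): on the left the right
     factor p_{w} selects phi(g,e).w, which is g.w by hypothesis. *)
  rewrite -cmulA ufam_up// image_set1 phi_vact// -cmulA ufam_pu//.
  congr (_ ** u _ _); rewrite setIid; apply/setIidr => _ ->.
  by exists w.
Qed.

End UltragraphToGraph.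

(** * From graph families to ultragraph families *)

Section GraphToUltragraph.
Variables (R : realType) (G : groupType) (U : ultragraph).
Variable S : ss_ultragraph G U.
Hypothesis Usf : usource_finite U.
Hypothesis phi_vact : forall g e v, usrc e v ->
  ssu_vact S (ssu_phi S g e) v = ssu_vact S g v.
Variables (A : cstarAlgType R) (F : gfamily G (assoc_graph U) A).
Hypothesis isF : is_gfamily (assoc_ss_graph phi_vact) F.

Local Notation vact := (ssu_vact S).
Local Notation eact := (ssu_eact S).
Local Notation phi := (ssu_phi S).
Local Notation q := (gfam_q F).
Local Notation z := (gfam_z F).

(** Extending the edges e^v by 0 to all pairs (e, v) keeps the membership
    proofs out of the sums. *)
Definition gfam_tt (e : uedge U) (v : uvert U) : A :=
  if insub (e, v) : option (agraph_edge U) is Some f then gfam_t F f else 0.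

Lemma gfam_tt_val f : gfam_tt (sval f).1 (sval f).2 = gfam_t F f.
Proof.
by rewrite /gfam_tt -surjective_pairing (valK f : insub (sval f) = Some f).
Qed.

Variant gfam_tt_spec e v : A -> Prop :=
| GfamEdge (ev : usrc e v) :
    gfam_tt_spec e v (gfam_t F (exist _ (e, v) (mem_set ev)))
| GfamNoEdge of ~ usrc e v : gfam_tt_spec e v 0.

Lemma gfam_ttP e v : gfam_tt_spec e v (gfam_tt e v).
Proof.
have [ev|nev] := pselect (usrc e v).
  by have /= -> := gfam_tt_val (exist _ (e, v) (mem_set ev)); constructor.
rewrite /gfam_tt insubN; first by constructor.
by apply/negP => /set_mem.
Qed.

(** Together with the next lemmas this is the multiplication table of the graph
    family in terms of the pairs (e, v), valid also off the edges. *)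
Lemma gfam_star_tt e v f w :
  star (gfam_tt e v) ** gfam_tt f w =
  if (e == f) && (v == w) && (v \in usrc e) then q v else 0.
Proof.
case: (gfam_ttP e v) => [ev|nev]; last first.
  rewrite star0 cmul0l (_ : (v \in _) = false) ?andbF//.
  by apply/negP => /set_mem.
case: (gfam_ttP f w) => [fw|nfw]; last first.
  rewrite cmul0r; case: ifP => // /andP[/andP[/eqP ef /eqP vw] _].
  by case: nfw; rewrite -ef -vw.
rewrite (mem_set ev) andbT; have [/andP[/eqP ef /eqP vw]|] := ifP.
  move: fw; rewrite -ef -vw => fw.
  by rewrite (Prop_irrelevance fw ev) (gfam_src isF).
move=> ne; apply: range_proj_orth; try exact: (gfam_pisom isF).
apply: (gfam_torth isF) => -[ef vw].
by rewrite ef vw !eqxx in ne.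
Qed.

Lemma gfam_tt_z1 e v : gfam_tt e v ** z v 1%g = gfam_tt e v.
Proof.
case: gfam_ttP => [ev|_]; last exact: cmul0l.
set f := exist _ _ _; rewrite (gfam_z1 isF).
rewrite -[v]/(gsrc (f : gedge (assoc_graph U))) -(gfam_src isF) cmulA.
by rewrite partial_isometryE//; exact: (gfam_pisom isF).
Qed.

Lemma gfam_star_z1 v : star (z v 1%g) = z v 1%g.
Proof. by rewrite (gfam_z1 isF); have [] := gfam_proj isF v. Qed.

Lemma gfam_tz e v w g :
  gfam_tt e v ** z w g = if v == w then gfam_tt e v ** z v g else 0.
Proof.
rewrite -gfam_tt_z1 -!cmulA !(gfam_zM isF) /= !(ssu_vactP S).1 eqxx mul1g.
by case: eqVneq => // _; rewrite cmul0r.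
Qed.

Lemma gfam_ztt v g e w :
  z v g ** gfam_tt e w =
  if v == vact g (urng_vert e)
  then gfam_tt (eact g e) (vact g w) ** z (vact g w) (phi g e) else 0.
Proof.
case: (gfam_ttP e w) => [ew|new].
  rewrite (gfam_zt isF) /=; case: eqP => // _.
  by congr (_ ** _); rewrite -gfam_tt_val.
rewrite cmul0r; case: gfam_ttP; rewrite ?cmul0l ?if_same// => ev.
case: new; move: ev; rewrite ssu_src_act => -[w' ew' /(congr1 (vact g^-1%g))].
by rewrite -!(ssu_vactP S).2 mulVg !(ssu_vactP S).1 => <-.
Qed.

Definition gfam_u (X : set (uvert U)) (g : G) : A := \sum_(v \in X) z v g.

Definition gfam_s (e : uedge U) : A := \sum_(v \in usrc e) gfam_tt e v.

Lemma gfam_u_star X g : finite_set X ->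
  star (gfam_u X g) = gfam_u (vact g^-1%g @` X) g^-1%g.
Proof.
move=> finX; rewrite star_fsum// /gfam_u fsbig_image.
  by apply: eq_fsbigr => v _; rewrite (gfam_star isF).
by move=> v w _ _; exact: vact_inj.
Qed.

(** For a fixed v the only nonzero summand on the left is the one at g^-1 v in
    Y, so v runs over the elements of X that lie in g Y. *)
Lemma gfam_uM X Y g h : finite_set X -> finite_set Y ->
  gfam_u X g ** gfam_u Y h = gfam_u (X `&` (vact g @` Y)) (g * h)%g.
Proof.
move=> finX finY; rewrite cmul_fsum// /gfam_u fsbig_mkcondr.
apply: eq_fsbigr => v _; rewrite in_vact_image.
under eq_fsbigr do rewrite (gfam_zM isF) /= vact_eq.
exact: (fsum_delta _ _ (fun=> z v (g * h)%g)).
Qed.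

Lemma gfam_sz e v g : gfam_s e ** z v g =
  if v \in usrc e then gfam_tt e v ** z v g else 0.
Proof.
rewrite cmul_fsuml//; under eq_fsbigr do rewrite gfam_tz eq_sym.
exact: (fsum_delta _ _ (fun w => gfam_tt e w ** z w g)).
Qed.

Lemma gfam_s_star_s e f :
  star (gfam_s e) ** gfam_s f = if e == f then gfam_u (usrc e) 1%g else 0.
Proof.
rewrite star_fsum// cmul_fsum//; case: eqVneq => [<-|ef]; last first.
  rewrite fsbig1// => v _; rewrite fsbig1// => w _.
  by rewrite gfam_star_tt (negPf ef).
apply: eq_fsbigr => v ev.
under eq_fsbigr do rewrite gfam_star_tt eqxx ev andbT /=.
by rewrite (fsum_delta _ _ (fun=> q v)) ev (gfam_z1 isF).
Qed.

Lemma gfam_s_z1 e v : usrc e v -> gfam_s e ** z v 1%g = gfam_tt e v.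
Proof. by move=> ev; rewrite gfam_sz (mem_set ev) gfam_tt_z1. Qed.

(** The off-diagonal terms t_(e^v) t_(e^w)^* vanish because of the orthogonal
    source projections q_v and q_w between the factors. *)
Lemma gfam_s_range e :
  range_proj (gfam_s e) = \sum_(v \in usrc e) range_proj (gfam_tt e v).
Proof.
rewrite /range_proj {2}/gfam_s star_fsum// cmul_fsumr//.
apply: eq_fsbigr => v /set_mem ev.
by rewrite -{1}(gfam_tt_z1 e v) starM gfam_star_z1 cmulA gfam_s_z1.
Qed.

(** Only the vertex g.r(e) of X contributes to the left-hand side, and only the
    diagonal terms to the product on the right; what remains on either side is
    the sum K over s(e). *)
Lemma gfam_us X g e : finite_set X ->
  gfam_u X g ** gfam_s e =
  if vact g (urng_vert e) \in X
  then gfam_s (eact g e) ** gfam_u (vact g @` usrc e) (phi g e) else 0.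
Proof.
move=> finX; rewrite cmul_fsum//.
pose K := \sum_(w \in usrc e)
  (gfam_tt (eact g e) (vact g w) ** z (vact g w) (phi g e)).
have gI : set_inj (usrc e) (vact g).
  by move=> v w _ _; exact: vact_inj.
have finge : finite_set (vact g @` usrc e) by exact: finite_image.
transitivity (\sum_(v \in X) if vact g (urng_vert e) == v then K else 0).
  apply: eq_fsbigr => v _; under eq_fsbigr do rewrite gfam_ztt eq_sym.
  by case: eqP => // _; exact: fsbig1.
rewrite (fsum_delta _ _ (fun=> K)); case: ifP => // _.
rewrite cmul_fsumr// /K -(fsbig_image _ (vact g)
  (fun v => gfam_tt (eact g e) v ** z v (phi g e)))//.
apply: eq_fsbigr => v ev; rewrite gfam_sz.
by rewrite ssu_src_act ev.
Qed.

Definition ultragraph_family : ufamily G U A :=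
  UFamily (fun X => gfam_u X 1%g) gfam_s gfam_u.

Lemma ultragraph_familyP : is_ufamily S ultragraph_family.
Proof.
have fin := uvertices_finite Usf.
have projU X : uvertices X -> projection (gfam_u X 1%g).
  move=> /fin finX; split; first by rewrite gfam_uM// vact1_image setIid mulg1.
  by rewrite gfam_u_star// invg1 vact1_image.
split=> /=.
- split=> //=.
  + move=> e; rewrite /partial_isometry gfam_s_star_s eqxx.
    by apply: projU; exact: uvertices_src.
  + move=> e f /eqP ef; rewrite /range_proj cmulA -(cmulA _ (star _)).
    by rewrite gfam_s_star_s (negPf ef) cmul0r cmul0l.
  + exact: fsbig_set0.
  + move=> X Y /fin finX /fin finY.
    by rewrite gfam_uM// vact1_image mulg1.
  + by move=> X Y /fin finX /fin finY; exact: fsumU.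
  + by move=> e; rewrite gfam_s_star_s eqxx.
  + move=> e; rewrite /proj_le gfam_s_range cmul_fsuml//.
    apply: eq_fsbigr => v _; rewrite /gfam_u urng_vertE fsbig_set1.
    case: gfam_ttP => [ev|_]; last by rewrite /range_proj !cmul0l.
    by rewrite (gfam_z1 isF); exact: (gfam_rng isF).
  + move=> v; rewrite /gfam_u fsbig_set1 (gfam_z1 isF) (gfam_sum isF).
    under eq_fsbigr do rewrite -gfam_tt_val.
    rewrite (agraph_fsum Usf (fun x => range_proj (gfam_tt x.1 x.2)));
      last exact: ssu_row_finite S.
    by apply: eq_fsbigr => e _; rewrite gfam_s_range.
- by [].
- by move=> X g /fin; exact: gfam_u_star.
- by move=> X Y g h /fin finX /fin; exact: gfam_uM.
- move=> X g e /fin finX; rewrite urng_vertE image_set1 => sub.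
  by rewrite gfam_us// (mem_set (sub _ erefl)).
- move=> X g e /fin finX; rewrite urng_vertE image_set1 => nsub.
  rewrite gfam_us// ifF//; apply/negP => /set_mem gX.
  by apply: nsub => _ ->.
Qed.

End GraphToUltragraph.

(** * The isomorphism *)

Theorem proposition4p3 (R : realType) (G : groupType) (U : ultragraph)
    (S : ss_ultragraph G U) (Usf : usource_finite U)
    (phi_vact : forall (g : G) (e : uedge U) (v : uvert U), usrc e v ->
      ssu_vact S (ssu_phi S g e) v = ssu_vact S g v)
    (A B : cstarAlgType R)
    (hA : is_ss_ultragraph_algebra S A)
    (hB : is_ss_graph_algebra (assoc_ss_graph phi_vact) B) :
  cstar_isomorphic A B.
Proof.
have [F [FP _ FU]] := hA; have [H [HP _ HU]] := hB.
have [a [[am [ap as_ au]] _]] := FU B _ (ultragraph_familyP Usf HP).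
have [b [[bm [bq bt bz]] _]] := HU A _ (graph_familyP Usf phi_vact FP).
have fin := uvertices_finite Usf.
have U1 := @uvertices_set1 U.
(* Both b \o a and the identity send the family F to itself. *)
have ba : b \o a = id.
  have [c [_ cU]] := FU A F FP; transitivity c; last first.
    by apply: cU; split; [exact: star_morphism_id|split].
  apply/esym/cU; split; first exact: star_morphism_comp.
  split=> [X UX|e|X g UX] /=.
  - rewrite ap// (star_morphism_fsum _ bm); last exact: fin.
    rewrite (ufam_p_sum Usf FP UX).
    by apply: eq_fsbigr => v _; rewrite (gfam_z1 HP) bq.
  - rewrite as_ (star_morphism_fsum _ bm)// (ufam_s_sum Usf FP e).
    apply: eq_fsbigr => v /set_mem ev.
    pose f : gedge (assoc_graph U) := exist _ (e, v) (mem_set ev).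
    by rewrite -[RHS](bt f) -gfam_tt_val.
  - rewrite au// (star_morphism_fsum _ bm); last exact: fin.
    rewrite (ufam_u_sum Usf FP g UX).
    by apply: eq_fsbigr => v _; rewrite bz.
have ab : a \o b = id.
  have [c [_ cU]] := HU B H HP; transitivity c; last first.
    by apply: cU; split; [exact: star_morphism_id|split].
  have [_ aM _] := am.
  apply/esym/cU; split; first exact: star_morphism_comp.
  split=> [v|f|v g] /=.
  - by rewrite bq ap//= /gfam_u fsbig_set1 (gfam_z1 HP).
  - rewrite bt /= aM as_ ap//= /gfam_u fsbig_set1 (gfam_s_z1 Usf HP).
      exact: gfam_tt_val.
    exact/set_mem/(svalP f).
  - by rewrite bz au//= /gfam_u fsbig_set1.
exists a; split=> //.
by exists b => x; [rewrite -[RHS]/(id x) -ba|rewrite -[RHS]/(id x) -ab].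
Qed.
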